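(* Let $\phi = (1+\sqrt{5})/2$ denote the golden ratio. Let $\mathbb{A} \subset \mathbb{R}^3$ be the set of all triples $(\rho,\sigma,\tau)\in\mathbb{R}^3$ such that $$\bigl| f(a,b,c,\rho) - f(b,c,a,\sigma) \bigr| < f(c,a,b,\tau) < f(a,b,c,\rho) + f(b,c,a,\sigma) \quad \text{for all } (a,b,c)\in\mathcal{T},$$ where $\mathcal{T} = \{(a,b,c)\in\mathbb{R}^3 : |a-b| < c < a+b\}$ and $f(a,b,c,\rho) = \sqrt{\rho(\rho-1)a^2+\rho b^2+(1-\rho)c^2}$ for $(a,b,c)\in\mathcal{T}$, $\rho\in\mathbb{R}$. Then $\mathbb{A}$ is the union of the following three sets: $$\Bigl\{ (\xi,\xi,\xi) : \xi\in\mathbb{R} \Bigr\},$$ $$\Bigl\{ (-\xi,\,2-\xi,\,\xi),\ (\xi,\,-\xi,\,2-\xi),\ (2-\xi,\,\xi,\,-\xi) : \xi\in\mathbb{R}\setminus\{-\phi^{-1},\phi\} \Bigr\},$$ and $$\Bigl\{ \bigl(\tfrac{1}{1-\xi},\,1-\tfrac{1}{\xi},\,\xi\bigr),\ \bigl(\xi,\,\tfrac{1}{1-\xi},\,1-\tfrac{1}{\xi}\bigr),\ \bigl(1-\tfrac{1}{\xi},\,\xi,\,\tfrac{1}{1-\xi}\bigr) : \xi\in(\phi,\phi^2) \Bigr\}.$$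
   Context: The set $\mathcal{T}$ is the set of triples of side lengths of non-degenerate triangles (the defining inequalities force $a,b,c>0$). For a triangle $ABC$ with $BC=a$, $CA=b$, $AB=c$, by Stewart's theorem $f(a,b,c,\rho)$ is the length of the cevian $AA_\rho$, where $A_\rho$ is the point of line $BC$ with $\overrightarrow{BA_\rho}=\rho\,\overrightarrow{BC}$; similarly $f(b,c,a,\sigma)=BB_\sigma$ with $\overrightarrow{CB_\sigma}=\sigma\,\overrightarrow{CA}$, and $f(c,a,b,\tau)=CC_\tau$ with $\overrightarrow{AC_\tau}=\tau\,\overrightarrow{AB}$. In particular the expression under the square root is positive for $(a,b,c)\in\mathcal{T}$ and every real $\rho$. Explicitly, $f(b,c,a,\sigma)=\sqrt{(1-\sigma)a^2+\sigma(\sigma-1)b^2+\sigma c^2}$ and $f(c,a,b,\tau)=\sqrt{\tau a^2+(1-\tau)b^2+\tau(\tau-1)c^2}$. Thus $\mathbb{A}$ is the set of all $(\rho,\sigma,\tau)$ such that for every non-degenerate triangle $ABC$ the cevians $AA_\rho$, $BB_\sigma$, $CC_\tau$ are the side lengths of a non-degenerate triangle. *)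

(* Defs.v *)
From Stdlib Require Import Reals.
Open Scope R_scope.

Definition phi : R := (1 + sqrt 5) / 2.

(* Side lengths of non-degenerate triangles; the inequalities force
   a, b, c > 0. *)
Definition triangle (a b c : R) : Prop := Rabs (a - b) < c < a + b.

(* Stewart's formula for the length of the cevian from A to the point of
   line BC dividing it as BA_rho = rho * BC, where BC = a, CA = b, AB = c.
   The radicand is positive whenever [triangle a b c], for every real rho, so
   the convention [sqrt x = 0] for [x < 0] plays no role on such triples. *)
Definition cevian (a b c rho : R) : R :=
  sqrt (rho * (rho - 1) * a ^ 2 + rho * b ^ 2 + (1 - rho) * c ^ 2).

(* The set of admissible (rho, sigma, tau), as a ternary predicate. *)
Definition bbA (rho sigma tau : R) : Prop :=
  forall a b c : R, triangle a b c ->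
    Rabs (cevian a b c rho - cevian b c a sigma) < cevian c a b tau
      < cevian a b c rho + cevian b c a sigma.

(* Main.v *)
From Stdlib Require Import Reals Lra.
Require Import Defs.
Open Scope R_scope.

(** Work with squared lengths. The cevians form a triangle iff the Heron form
    [heron] is positive on their squares, and these squares are linear in
    [(u, v, w) = (a^2, b^2, c^2)]; so [(rho, sigma, tau)] is admissible iff a
    linear map preserves the cone of squared side lengths. On the boundary of
    the cone (collinear [A], [B], [C] with signed sides [p], [q], [-(p + q)])
    the Heron form of the cevians is a product of four linear forms in
    [(p, q)]. If it never becomes negative, then either one factor vanishes
    identically, which gives the first two families, or the factors are
    pairwise proportional. In the latter case the three cevians are always
    parallel with fixed ratios, and the sign of a sextic in [rho] decides. *)

(** * Heron form and squared cevians *)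

Definition heron (u v w : R) : R :=
  2 * (u * v + v * w + w * u) - u ^ 2 - v ^ 2 - w ^ 2.

Definition cev_sq (u v w r : R) : R := r * (r - 1) * u + r * v + (1 - r) * w.

Definition cone_preserving (rho sigma tau : R) : Prop :=
  forall u v w : R, 0 < u -> 0 < v -> 0 < w -> 0 < heron u v w ->
    0 < heron (cev_sq u v w rho) (cev_sq v w u sigma) (cev_sq w u v tau).

Lemma heron_sq (x y z : R) :
  heron (x ^ 2) (y ^ 2) (z ^ 2) =
    (x + y + z) * ((y + z - x) * ((x + z - y) * (x + y - z))).
Proof. unfold heron; ring. Qed.

Lemma heron_cycle (u v w : R) : heron v w u = heron u v w.
Proof. unfold heron; ring. Qed.

(** Relabelling the vertices cyclically; it lets one representative stand for each cyclic family. *)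
Lemma cone_preserving_cycle (r s t : R) :
  cone_preserving r s t -> cone_preserving s t r.
Proof.
intros H u v w hu hv hw h; rewrite <- heron_cycle, <- heron_cycle.
apply H; trivial.
now rewrite <- heron_cycle.
Qed.

Lemma triangle_pos (a b c : R) : triangle a b c -> 0 < a /\ 0 < b /\ 0 < c.
Proof.
unfold triangle, Rabs; destruct (Rcase_abs (a - b)); lra.
Qed.

Lemma triangle_heron (a b c : R) : 0 < a -> 0 < b -> 0 < c ->
  (triangle a b c <-> 0 < heron (a ^ 2) (b ^ 2) (c ^ 2)).
Proof.
intros ha hb hc; rewrite heron_sq; split.
- intros [h1 h2]; apply Rabs_def2 in h1; repeat apply Rmult_lt_0_compat; lra.
- intros h.
  assert (h' : 0 < (b + c - a) * ((a + c - b) * (a + b - c))).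
  { apply Rmult_lt_reg_l with (a + b + c); lra. }
  assert (N : forall x y z, 0 < x * (y * z) -> 0 < y -> 0 < z -> 0 < x).
  { intros x y z hp hy hz; apply Rmult_lt_reg_r with (y * z); [nra|lra]. }
  (* Two of the factors have a positive sum, so at most one is nonpositive. *)
  assert (0 < b + c - a).
  { destruct (Rle_or_lt (b + c - a) 0); trivial; apply (N _ _ _ h'); lra. }
  assert (0 < a + c - b).
  { destruct (Rle_or_lt (a + c - b) 0); trivial.
    apply (N _ (b + c - a) (a + b - c)); lra. }
  assert (0 < a + b - c).
  { destruct (Rle_or_lt (a + b - c) 0); trivial.
    apply (N _ (b + c - a) (a + c - b)); lra. }
  split; [apply Rabs_def1|]; lra.
Qed.

(** As a quadratic in [r], the squared cevian has leading coefficient [u] and discriminant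
    [- heron u v w]; the proof completes the square. *)
Lemma cev_sq_pos (u v w r : R) :
  0 < u -> 0 < heron u v w -> 0 < cev_sq u v w r.
Proof.
intros hu h; apply Rmult_lt_reg_l with (4 * u); [lra|].
replace (4 * u * cev_sq u v w r) with ((2 * r * u + v - w - u) ^ 2 + heron u v w)
  by (unfold heron, cev_sq; ring).
assert (h' := pow2_ge_0 (2 * r * u + v - w - u)); lra.
Qed.

Lemma triangle_sqrt (x y z : R) : 0 < x -> 0 < y -> 0 < z ->
  (triangle (sqrt x) (sqrt y) (sqrt z) <-> 0 < heron x y z).
Proof.
intros hx hy hz; rewrite triangle_heron by now apply sqrt_lt_R0.
rewrite !pow2_sqrt by lra; reflexivity.
Qed.

Lemma bbA_cone_preserving (r s t : R) : bbA r s t <-> cone_preserving r s t.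
Proof.
assert (key : forall u v w, 0 < u -> 0 < v -> 0 < w -> 0 < heron u v w ->
  (triangle (sqrt (cev_sq u v w r)) (sqrt (cev_sq v w u s))
     (sqrt (cev_sq w u v t)) <->
   0 < heron (cev_sq u v w r) (cev_sq v w u s) (cev_sq w u v t))).
{ intros u v w hu hv hw h; apply triangle_sqrt; apply cev_sq_pos; trivial.
  - now rewrite heron_cycle.
  - now rewrite <- heron_cycle. }
split.
- intros H u v w hu hv hw h; apply key; trivial.
  assert (T : triangle (sqrt u) (sqrt v) (sqrt w)) by now apply triangle_sqrt.
  generalize (H _ _ _ T); unfold cevian; rewrite !pow2_sqrt by lra; trivial.
- intros H a b c T; destruct (triangle_pos _ _ _ T) as (ha & hb & hc).
  assert (h := proj1 (triangle_heron a b c ha hb hc) T).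
  assert (0 < a ^ 2) by now apply pow_lt.
  assert (0 < b ^ 2) by now apply pow_lt.
  assert (0 < c ^ 2) by now apply pow_lt.
  apply key; trivial; now apply H.
Qed.

(** * Golden ratio identities *)

Lemma phi_sq : phi ^ 2 = phi + 1.
Proof.
assert (h : sqrt 5 ^ 2 = 5) by (apply pow2_sqrt; lra).
unfold phi; nra.
Qed.

Lemma phi_bounds : 3 / 2 < phi < 2.
Proof.
assert (h := phi_sq).
assert (0 < phi) by (unfold phi; assert (0 <= sqrt 5) by apply sqrt_pos; lra).
nra.
Qed.

Lemma inv_phi : / phi = phi - 1.
Proof.
assert (h := phi_sq); assert (b := phi_bounds).
apply Rmult_eq_reg_l with phi; [rewrite Rinv_r|]; nra.
Qed.

Lemma golden_quadratic (x : R) : x ^ 2 - x - 1 = (x - phi) * (x + / phi).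
Proof. rewrite inv_phi; assert (h := phi_sq); lra. Qed.

(** * The three families of solutions *)

Lemma cone_preserving_diag (x : R) : cone_preserving x x x.
Proof.
intros u v w _ _ _ h.
replace (heron _ _ _) with ((x ^ 2 - x + 1) ^ 2 * heron u v w)
  by (unfold heron, cev_sq; ring).
apply Rmult_lt_0_compat; trivial; apply pow_lt; nra.
Qed.

Lemma heron_cev_second (u v w x : R) :
  heron (cev_sq u v w (- x)) (cev_sq v w u (2 - x)) (cev_sq w u v x) =
    (x ^ 2 - x - 1) ^ 2 * heron u v w.
Proof. unfold heron, cev_sq; ring. Qed.

Lemma cone_preserving_second (x : R) :
  cone_preserving (- x) (2 - x) x <-> x <> - / phi /\ x <> phi.
Proof.
split.
- intros H.
  (* The scaling factor depends only on [x], so the equilateral triangle already detects its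
     zeros. *)
  assert (h : 0 < heron 1 1 1) by (unfold heron; lra).
  generalize (H 1 1 1 Rlt_0_1 Rlt_0_1 Rlt_0_1 h).
  rewrite heron_cev_second, golden_quadratic.
  intros h'; split; intros ->; apply (Rlt_irrefl 0); eapply Rlt_le_trans;
    try exact h'; right; ring.
- intros [h1 h2] u v w _ _ _ h; rewrite heron_cev_second, golden_quadratic.
  apply Rmult_lt_0_compat; trivial.
  rewrite <- Rsqr_pow2; apply Rsqr_pos_lt, Rmult_integral_contrapositive; lra.
Qed.

(** Cevians in the ratio [|x (x - 1)| : |x| : |x - 1|] have a Heron form proportional to
    [(x ^ 2 - x + 1) * - sextic x]; the quadratics are Heron factors up to sign. *)
Definition sextic (x : R) : R :=
  (x ^ 2 + x - 1) * (x ^ 2 - 3 * x + 1) * (x ^ 2 - x - 1).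

(* The parameters for which the three cevians are parallel. *)
Lemma heron_cev_third (u v w x : R) : x <> 0 -> x <> 1 ->
  heron (cev_sq u v w x) (cev_sq v w u (1 / (1 - x))) (cev_sq w u v (1 - 1 / x))
  = (cev_sq u v w x / (x * (x - 1)) ^ 2) ^ 2 * ((x ^ 2 - x + 1) * - sextic x).
Proof.
intros h0 h1; unfold heron, cev_sq, sextic; field; repeat split; lra.
Qed.

Lemma cone_preserving_third (x : R) : x <> 0 -> x <> 1 ->
  (cone_preserving x (1 / (1 - x)) (1 - 1 / x) <-> sextic x < 0).
Proof.
intros h0 h1.
assert (hq : 0 < x ^ 2 - x + 1) by nra.
assert (hd : 0 < (x * (x - 1)) ^ 2).
{ rewrite <- Rsqr_pow2; apply Rsqr_pos_lt, Rmult_integral_contrapositive; lra. }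
assert (key : forall u v w, 0 < u -> 0 < heron u v w ->
  0 < (cev_sq u v w x / (x * (x - 1)) ^ 2) ^ 2 * (x ^ 2 - x + 1)).
{ intros u v w hu h; apply Rmult_lt_0_compat; trivial.
  apply pow_lt, Rdiv_lt_0_compat; trivial; now apply cev_sq_pos. }
split.
- intros H.
  assert (h : 0 < heron 1 1 1) by (unfold heron; lra).
  generalize (H 1 1 1 Rlt_0_1 Rlt_0_1 Rlt_0_1 h) (key 1 1 1 Rlt_0_1 h).
  rewrite heron_cev_third, <- Rmult_assoc by trivial; nra.
- intros hs u v w hu hv hw h; rewrite heron_cev_third, <- Rmult_assoc by trivial.
  apply Rmult_lt_0_compat; [now apply key|lra].
Qed.

(** The six roots are listed in increasing order and paired consecutively, so each pair is negative
    exactly on one of three disjoint intervals. *)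
Lemma sextic_phi (x : R) :
  sextic x = (x - - phi) * (x - (1 - phi)) *
    (((x - (2 - phi)) * (x - (phi - 1))) * ((x - phi) * (x - (phi + 1)))).
Proof.
assert (h := phi_sq); unfold sextic.
replace (x ^ 2 + x - 1) with ((x - - phi) * (x - (phi - 1))) by lra.
replace (x ^ 2 - 3 * x + 1) with ((x - (2 - phi)) * (x - (phi + 1))) by lra.
replace (x ^ 2 - x - 1) with ((x - (1 - phi)) * (x - phi)) by lra.
ring.
Qed.

Lemma sextic_neg (x : R) : sextic x < 0 <->
  - phi < x < 1 - phi \/ 2 - phi < x < phi - 1 \/ phi < x < phi + 1.
Proof.
assert (b := phi_bounds); rewrite sextic_phi.
assert (neg : forall l r, l < r -> ((x - l) * (x - r) < 0 <-> l < x < r)).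
{ intros l r h; split; [intros h'; split|]; nra. }
assert (pos : forall l r, l < r -> x < l \/ r < x -> 0 < (x - l) * (x - r)).
{ intros l r h [h' | h']; nra. }
split.
- rewrite <- !neg by lra.
  generalize ((x - - phi) * (x - (1 - phi)))
    ((x - (2 - phi)) * (x - (phi - 1))) ((x - phi) * (x - (phi + 1))).
  intros A B C h.
  destruct (Rlt_or_le A 0), (Rlt_or_le B 0), (Rlt_or_le C 0); auto.
  (* With no negative pair, the product would be nonnegative. *)
  exfalso; revert h; apply Rle_not_lt.
  now repeat apply Rmult_le_pos.
- intros [h | [h | h]].
  + assert (h1 := proj2 (neg (- phi) (1 - phi) ltac:(lra)) h).
    assert (h2 := pos (2 - phi) (phi - 1) ltac:(lra) ltac:(lra)).
    assert (h3 := pos phi (phi + 1) ltac:(lra) ltac:(lra)).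
    assert (h4 := Rmult_lt_0_compat _ _ h2 h3); nra.
  + assert (h1 := pos (- phi) (1 - phi) ltac:(lra) ltac:(lra)).
    assert (h2 := proj2 (neg (2 - phi) (phi - 1) ltac:(lra)) h).
    assert (h3 := pos phi (phi + 1) ltac:(lra) ltac:(lra)).
    assert (h4 := Rmult_lt_0_compat _ _ h1 h3); nra.
  + assert (h1 := pos (- phi) (1 - phi) ltac:(lra) ltac:(lra)).
    assert (h2 := pos (2 - phi) (phi - 1) ltac:(lra) ltac:(lra)).
    assert (h3 := proj2 (neg phi (phi + 1) ltac:(lra)) h).
    assert (h4 := Rmult_lt_0_compat _ _ h1 h2); nra.
Qed.

(** * Passing to the boundary of the cone *)

Lemma cubic_nonneg_at_zero (a b c d : R) :
  (forall t, 0 < t -> 0 <= a + b * t + c * t ^ 2 + d * t ^ 3) -> 0 <= a.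
Proof.
intros h; apply Rnot_lt_le; intros ha.
(* If [a < 0], then at [t = - a / M], which is below 1, the cubic is at most [- t * (1 - a) < 0]. *)
set (M := 1 - a + Rabs b + Rabs c + Rabs d).
assert (hb := Rabs_pos b); assert (hc := Rabs_pos c); assert (hd := Rabs_pos d).
assert (hM : 0 < M) by (unfold M; lra).
set (t := - a / M).
assert (ht : 0 < t) by (apply Rdiv_lt_0_compat; lra).
assert (htM : t * M = - a) by (unfold t; field; lra).
assert (ht1 : t < 1).
{ apply Rmult_lt_reg_r with M; trivial; rewrite htM; unfold M; lra. }
assert (h1 := h t ht).
assert (term : forall x y, 0 <= y <= t -> x * y <= Rabs x * t).
{ intros x y hy; apply Rle_trans with (Rabs x * y).
  - apply Rmult_le_compat_r, Rle_abs; lra.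
  - apply Rmult_le_compat_l; [apply Rabs_pos|lra]. }
assert (h2 := term b t ltac:(lra)).
assert (h3 := term c (t ^ 2) ltac:(nra)).
assert (h4 := term d (t ^ 3) ltac:(assert (0 <= t ^ 2 <= 1); nra)).
unfold M in htM; nra.
Qed.

(** For collinear vertices the squared cevians are squares of linear forms in the signed sides;
    nonnegativity survives as a limit from inside the cone. *)
Lemma heron_boundary (r s t p q : R) : cone_preserving r s t ->
  0 <= heron (((r - 1) * p - q) ^ 2) ((p + s * q) ^ 2)
         ((- t * p + (1 - t) * q) ^ 2).
Proof.
intros H.
set (u := p ^ 2); set (v := q ^ 2); set (w := (p + q) ^ 2).
assert (hu : 0 <= u) by apply pow2_ge_0.
assert (hv : 0 <= v) by apply pow2_ge_0.
assert (hw : 0 <= w) by apply pow2_ge_0.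
set (X := cev_sq u v w r); set (Y := cev_sq v w u s); set (Z := cev_sq w u v t).
replace (((r - 1) * p - q) ^ 2) with X by (unfold X, cev_sq, u, v, w; ring).
replace ((p + s * q) ^ 2) with Y by (unfold Y, cev_sq, u, v, w; ring).
replace ((- t * p + (1 - t) * q) ^ 2) with Z by (unfold Z, cev_sq, u, v, w; ring).
(* Translation by [e * (1, 1, 1)] moves a boundary point into the cone. *)
set (r' := r * (r - 1) + 1); set (s' := s * (s - 1) + 1);
set (t' := t * (t - 1) + 1).
(* Here [r'], [s'], [t'] are the squared cevians at [(1, 1, 1)], and [b], [c] are the coefficients
   of [e] and [e ^ 2] in the translated Heron form. *)
apply cubic_nonneg_at_zero with
  (d := 0)
  (b := 2 * (X * s' + r' * Y + Y * t' + s' * Z + Z * r' + t' * X)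
        - 2 * X * r' - 2 * Y * s' - 2 * Z * t')
  (c := heron r' s' t').
intros e he.
assert (hh : 0 < heron (u + e) (v + e) (w + e)).
{ replace (heron (u + e) (v + e) (w + e)) with (2 * e * (u + v + w) + 3 * e ^ 2)
    by (unfold heron, u, v, w; ring).
  assert (0 < e ^ 2) by now apply pow_lt.
  assert (0 <= e * (u + v + w)) by (apply Rmult_le_pos; lra).
  lra. }
generalize (H (u + e) (v + e) (w + e) ltac:(lra) ltac:(lra) ltac:(lra) hh).
intros h; eapply Rle_trans; [apply Rlt_le, h|]; right.
unfold heron, X, Y, Z, r', s', t', cev_sq; ring.
Qed.

(** The cubic is nonnegative for [e > 0] and nonpositive for [e < 0], so its value at 0 is both. *)
Lemma sign_change_zero (k0 k1 k2 k3 : R) :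
  (forall e, 0 <= e * (k0 + k1 * e + k2 * e ^ 2 + k3 * e ^ 3)) -> k0 = 0.
Proof.
intros h.
apply Rle_antisym.
- cut (0 <= - k0); [lra|].
  apply cubic_nonneg_at_zero with (b := k1) (c := - k2) (d := k3).
  intros t ht; apply Rmult_le_reg_l with t; trivial.
  generalize (h (- t)); lra.
- apply cubic_nonneg_at_zero with (b := k1) (c := k2) (d := k3).
  intros t ht; apply Rmult_le_reg_l with t; trivial.
  generalize (h t); lra.
Qed.

(** * Products of linear forms that never become negative *)

Definition lin (v : R * R) (p q : R) : R := fst v * p + snd v * q.

(** Zero is parallel to everything, hence the nonzero middle vector in transitivity. *)
Definition parallel (v w : R * R) : Prop := fst v * snd w = fst w * snd v.

Lemma parallel_sym (v w : R * R) : parallel v w -> parallel w v.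
Proof. intros h; exact (eq_sym h). Qed.

Lemma parallel_trans (u v w : R * R) :
  u <> (0, 0) -> parallel u v -> parallel u w -> parallel v w.
Proof.
destruct u as [a b], v as [c d], w as [e f]; unfold parallel; simpl.
intros nz h1 h2.
assert (ea : a * (c * f - e * d) = 0).
{ replace (a * (c * f - e * d)) with (c * (a * f - e * b) - e * (a * d - c * b))
    by ring; rewrite h1, h2; ring. }
assert (eb : b * (c * f - e * d) = 0).
{ replace (b * (c * f - e * d)) with (d * (a * f - e * b) - f * (a * d - c * b))
    by ring; rewrite h1, h2; ring. }
destruct (Req_dec (c * f - e * d) 0) as [h | h]; [lra|].
apply Rmult_integral in ea; apply Rmult_integral in eb.
destruct nz; f_equal; tauto.
Qed.

(** Otherwise only the first factor vanishes on its kernel line, and the product changes sign across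
    that line. *)
Lemma factor_parallel (v1 v2 v3 v4 : R * R) :
  (forall p q, 0 <= lin v1 p q * (lin v2 p q * (lin v3 p q * lin v4 p q))) ->
  v1 <> (0, 0) -> parallel v1 v2 \/ parallel v1 v3 \/ parallel v1 v4.
Proof.
destruct v1 as [a1 b1], v2 as [a2 b2], v3 as [a3 b3], v4 as [a4 b4].
unfold lin, parallel; simpl; intros h nz.
assert (hn : 0 < a1 ^ 2 + b1 ^ 2).
{ assert (h1 := pow2_ge_0 a1); assert (h2 := pow2_ge_0 b1).
  destruct (Req_dec a1 0) as [-> | ha]; [|assert (0 < a1 ^ 2); [nra|lra]].
  destruct (Req_dec b1 0) as [-> | hb]; [tauto|nra]. }
(* [Di] and [Si] are the values of the i-th factor at [(- b1, a1)] and [(a1, b1)]. *)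
set (D2 := a1 * b2 - a2 * b1); set (D3 := a1 * b3 - a3 * b1);
set (D4 := a1 * b4 - a4 * b1).
set (S2 := a1 * a2 + b1 * b2); set (S3 := a1 * a3 + b1 * b3);
set (S4 := a1 * a4 + b1 * b4).
assert (h0 : D2 * D3 * D4 = 0).
{ apply sign_change_zero with
    (k1 := S2 * D3 * D4 + D2 * S3 * D4 + D2 * D3 * S4)
    (k2 := S2 * S3 * D4 + S2 * D3 * S4 + D2 * S3 * S4) (k3 := S2 * S3 * S4).
  intros e; apply Rmult_le_reg_l with (a1 ^ 2 + b1 ^ 2); trivial.
  rewrite Rmult_0_r.
  (* Along [e * (a1, b1) + (- b1, a1)] the first factor vanishes at [e = 0]. *)
  eapply Rle_trans; [apply (h (- b1 + e * a1) (a1 + e * b1))|]; right.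
  unfold D2, D3, D4, S2, S3, S4; ring. }
apply Rmult_integral in h0; destruct h0 as [h0 | h0];
  [apply Rmult_integral in h0; destruct h0 as [h0 | h0]|];
  unfold D2, D3, D4 in h0; lra.
Qed.

(** On nonzero vectors parallelism is an equivalence; every class has at least two of the four
    members, so they split into two pairs. *)
Lemma four_factors_parallel (v1 v2 v3 v4 : R * R) :
  (forall p q, 0 <= lin v1 p q * (lin v2 p q * (lin v3 p q * lin v4 p q))) ->
  v1 <> (0, 0) -> v2 <> (0, 0) -> v3 <> (0, 0) -> v4 <> (0, 0) ->
  (parallel v1 v2 /\ parallel v3 v4) \/ (parallel v1 v3 /\ parallel v2 v4) \/
  (parallel v1 v4 /\ parallel v2 v3).
Proof.
intros h n1 n2 n3 n4.
assert (P1 := factor_parallel _ _ _ _ h n1).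
assert (P2 : parallel v2 v1 \/ parallel v2 v3 \/ parallel v2 v4).
{ apply factor_parallel; trivial; intros p q; generalize (h p q); lra. }
assert (P3 : parallel v3 v1 \/ parallel v3 v2 \/ parallel v3 v4).
{ apply factor_parallel; trivial; intros p q; generalize (h p q); lra. }
assert (P4 : parallel v4 v1 \/ parallel v4 v2 \/ parallel v4 v3).
{ apply factor_parallel; trivial; intros p q; generalize (h p q); lra. }
assert (T1 := fun v w => parallel_trans _ v w n1).
assert (T2 := fun v w => parallel_trans _ v w n2).
assert (T3 := fun v w => parallel_trans _ v w n3).
assert (T4 := fun v w => parallel_trans _ v w n4).
decompose [or] P1; decompose [or] P2; decompose [or] P3; decompose [or] P4;
  clear P1 P2 P3 P4; eauto 6 using parallel_sym.
Qed.

(* Proportionality of a Heron factor to another one reads [x] parallel to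
   [y + z] or to [y - z], up to permutation; two disjoint pairs give both. *)
Lemma heron_factors_parallel (xp xq yp yq zp zq : R) :
  (forall p q, 0 <= heron ((xp * p + xq * q) ^ 2) ((yp * p + yq * q) ^ 2)
     ((zp * p + zq * q) ^ 2)) ->
  (xp + yp + zp, xq + yq + zq) <> (0, 0) ->
  (yp + zp - xp, yq + zq - xq) <> (0, 0) ->
  (xp + zp - yp, xq + zq - yq) <> (0, 0) ->
  (xp + yp - zp, xq + yq - zq) <> (0, 0) ->
  (yp, yq) <> (0, 0) -> (zp, zq) <> (0, 0) ->
  parallel (xp, xq) (yp, yq) /\ parallel (xp, xq) (zp, zq).
Proof.
intros h n1 n2 n3 n4 ny nz.
assert (TY := parallel_trans _ (xp, xq) (zp, zq) ny).
assert (TZ := parallel_trans _ (xp, xq) (yp, yq) nz).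
assert (P := fun h' => four_factors_parallel _ _ _ _ h' n1 n2 n3 n4).
unfold lin, parallel in *; cbn [fst snd] in *.
destruct P as [P | [P | P]].
- intros p q; generalize (h p q); rewrite heron_sq; intros h'.
  eapply Rle_trans; [exact h'|right; ring].
- lra.
- assert (xp * yq = yp * xq) by lra; split; [|apply TY]; lra.
- assert (xp * zq = zp * xq) by lra; split; [apply TZ|]; lra.
Qed.

Lemma vec_dec (v : R * R) : {v = (0, 0)} + {v <> (0, 0)}.
Proof.
destruct v as [a b].
destruct (Req_dec_T a 0) as [-> | ha]; [|right; congruence].
destruct (Req_dec_T b 0) as [-> | hb]; [now left|right; congruence].
Qed.

(** * Classification of the parameters *)

Lemma cone_preserving_cases (r s t : R) : cone_preserving r s t ->
  (r = t /\ s = t) \/ (s = - r /\ t = 2 - r) \/ (r = 2 - s /\ t = - s) \/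
  (r = - t /\ s = 2 - t) \/
  (r <> 0 /\ r <> 1 /\ s = 1 / (1 - r) /\ t = 1 - 1 / r).
Proof.
intros H.
assert (P := heron_factors_parallel (r - 1) (- 1) 1 s (- t) (1 - t)).
assert (inv : forall a b, (a, b) = (0, 0) -> a = 0 /\ b = 0)
  by (intros a b e; injection e; auto).
(* Identical vanishing of the four Heron factors gives the first four cases, in this order. *)
match type of P with _ -> ?a <> _ -> ?b <> _ -> ?c <> _ -> ?d <> _ -> _ =>
  destruct (vec_dec a) as [e | n1]; [apply inv in e; lra|];
  destruct (vec_dec b) as [e | n2]; [apply inv in e; lra|];
  destruct (vec_dec c) as [e | n3]; [apply inv in e; lra|];
  destruct (vec_dec d) as [e | n4]; [apply inv in e; lra|] end.
destruct P as [Py Pz]; trivial.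
- intros p q; replace ((r - 1) * p + - 1 * q) with ((r - 1) * p - q) by ring.
  rewrite Rmult_1_l; now apply heron_boundary.
- intros e; apply inv in e; lra.
- intros e; apply inv in e; lra.
(* Parallelism now reads [(r - 1) * s = - 1] and [r * t = r - 1]. *)
- unfold parallel in Py, Pz; simpl in Py, Pz.
  assert (h0 : r <> 0) by (intros ->; lra).
  assert (h1 : r <> 1) by (intros ->; lra).
  do 4 right; repeat split; trivial.
  + apply Rmult_eq_reg_r with (1 - r); [|lra].
    transitivity 1; [lra|field; lra].
  + apply Rmult_eq_reg_r with r; trivial.
    transitivity (r - 1); [lra|field; lra].
Qed.

Theorem mainTheorem1 :
  forall rho sigma tau : R,
    bbA rho sigma tau <->
    (exists xi : R, (rho, sigma, tau) = (xi, xi, xi))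
    \/
    (exists xi : R, xi <> - / phi /\ xi <> phi /\
       ((rho, sigma, tau) = (- xi, 2 - xi, xi) \/
        (rho, sigma, tau) = (xi, - xi, 2 - xi) \/
        (rho, sigma, tau) = (2 - xi, xi, - xi)))
    \/
    (exists xi : R, phi < xi < phi ^ 2 /\
       ((rho, sigma, tau) = (1 / (1 - xi), 1 - 1 / xi, xi) \/
        (rho, sigma, tau) = (xi, 1 / (1 - xi), 1 - 1 / xi) \/
        (rho, sigma, tau) = (1 - 1 / xi, xi, 1 / (1 - xi)))).
Proof.
intros r s t; rewrite bbA_cone_preserving, phi_sq; assert (b := phi_bounds).
split.
- intros H.
  destruct (cone_preserving_cases r s t H)
    as [[-> ->] | [[-> ->] | [[-> ->] | [[-> ->] | (h0 & h1 & -> & ->)]]]].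
  + left; now exists t.
  + right; left; exists r.
    apply cone_preserving_cycle, cone_preserving_second in H; tauto.
  + right; left; exists s.
    apply cone_preserving_cycle, cone_preserving_cycle in H.
    apply cone_preserving_second in H; tauto.
  + right; left; exists t; apply cone_preserving_second in H; tauto.
  + right; right.
    apply cone_preserving_third, sextic_neg in H; trivial.
    (* The order-three map sending [x] to [1 / (1 - x)] permutes the three intervals cyclically; the
       witness is the coordinate lying between [phi] and [phi + 1]. *)
    destruct H as [h | [h | h]].
    * exists (1 - 1 / r); split.
      { replace (1 - 1 / r) with (1 + / - r) by (field; lra).
        assert (e : - r * / - r = 1) by (apply Rinv_r; lra).
        assert (g := phi_sq); split; nra. }
      left; apply f_equal2; [apply f_equal2|]; field; repeat split; lra.
    * exists (1 / (1 - r)); split.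
      { assert (e : (1 - r) * (1 / (1 - r)) = 1) by (field; lra).
        assert (g := phi_sq); split; nra. }
      right; right; apply f_equal2; [apply f_equal2|]; field; repeat split; lra.
    * exists r; auto.
- intros [[x e] | [(x & h1 & h2 & e) | (x & h & e)]].
  + injection e as -> -> ->; apply cone_preserving_diag.
  + assert (H := proj2 (cone_preserving_second x) (conj h1 h2)).
    destruct e as [e | [e | e]]; injection e as -> -> ->; trivial.
    * now do 2 apply cone_preserving_cycle.
    * now apply cone_preserving_cycle.
  + assert (H := proj2 (cone_preserving_third x ltac:(lra) ltac:(lra))
      (proj2 (sextic_neg x) (or_intror (or_intror h)))).
    destruct e as [e | [e | e]]; injection e as -> -> ->; trivial.
    * now apply cone_preserving_cycle.
    * now do 2 apply cone_preserving_cycle.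
Qed.
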